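(* Let $G_m$ be a bounded Vilenkin group and $0<p<1$. a) The maximal operator $$\widetilde L_p^*f:=\sup_{n\ge2}\frac{|L_nf|}{(n+1)^{1/p-1}}$$ is bounded from the Hardy space $H_p(G_m)$ to the space $L_p(G_m)$. b) Let $\varphi:\mathbb{N}_+\to[1,\infty)$ be a non-decreasing function satisfying $$\limsup_{n\to\infty}\frac{n^{1/p-1}}{\log n\;\varphi(n)}=+\infty .$$ Then the maximal operator $$f\mapsto\sup_{n\ge2}\frac{|L_nf|}{\varphi(n+1)}$$ is not bounded from the Hardy space $H_p(G_m)$ to the space $L_p(G_m)$, i.e. there is no constant $C$ such that the $L_p$ quasi-norm of its value at $f$ is at most $C\|f\|_{H_p}$ for all $f\in H_p(G_m)$.
   Context: Let $m=(m_0,m_1,\ldots)$ be a fixed sequence of integers $m_k\ge 2$ with $\sup_k m_k<\infty$. $G_m=\prod_{k\ge0}Z_{m_k}$, $Z_{m_k}=\{0,\ldots,m_k-1\}$ the integers mod $m_k$, is the bounded Vilenkin group with product (of discrete) topology and normalized Haar measure $\mu$. $I_0(x)=G_m$, $I_n(x)=\{y\in G_m: y_0=x_0,\ldots,y_{n-1}=x_{n-1}\}$. $M_0=1$, $M_{k+1}=m_kM_k$; every $n\in\mathbb{N}$ is uniquely $n=\sum_j n_jM_j$ with $n_j\in Z_{m_j}$. $r_k(x)=\exp(2\pi i x_k/m_k)$ and $\psi_n=\prod_k r_k^{n_k}$ (Vilenkin system). $\mathbb{N}_+=\{1,2,\ldots\}$, $\mathbb{N}=\mathbb{N}_+\cup\{0\}$.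 For $f\in L_1(G_m)$: $\widehat f(n)=\int_{G_m} f\overline{\psi_n}\,d\mu$; $S_0f=0$, $S_nf=\sum_{k=0}^{n-1}\widehat f(k)\psi_k$. $\|g\|_p=(\int_{G_m}|g|^pd\mu)^{1/p}$. Let $\mathcal F_n$ be the $\sigma$-algebra generated by the sets $I_n(x)$, $x\in G_m$. A martingale is a sequence $f=(f^{(n)}:n\in\mathbb{N})$ of integrable functions with $f^{(n)}$ $\mathcal F_n$-measurable and $S_{M_n}f^{(l)}=f^{(n)}$ for $n\le l$. $f^*=\sup_n|f^{(n)}|$; $H_p=H_p(G_m)$ ($0<p<\infty$) is the space of martingales with $\|f\|_{H_p}:=\|f^*\|_p<\infty$. For a martingale, $\widehat f(i)=\lim_{k\to\infty}\int_{G_m}f^{(k)}\overline{\psi_i}\,d\mu$ and $S_nf=\sum_{k=0}^{n-1}\widehat f(k)\psi_k$. Nörlund logarithmic means: for $n\ge2$, $L_nf=\frac1{l_n}\sum_{k=1}^{n-1}\frac{S_kf}{n-k}$ with $l_n=\sum_{k=1}^{n-1}\frac1k$. An operator $A$ is bounded from $H_p$ to $L_p$ if there is a constant $C$ with $\|Af\|_p\le C\|f\|_{H_p}$ for all $f\in H_p$. *)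

(* Defs.v *)
From HB Require Import structures.
From mathcomp Require Import all_boot all_order all_algebra.
From mathcomp Require Import complex.
From mathcomp Require Import all_classical all_reals all_analysis.

Set Implicit Arguments.
Unset Strict Implicit.
Unset Printing Implicit Defensive.

Import Order.TTheory GRing.Theory Num.Theory.
Import numFieldNormedType.Exports.
Import ComplexField.Normc.

Local Open Scope classical_set_scope.
Local Open Scope ring_scope.
Local Open Scope complex_scope.

(* 'Z_q is the ring of integers mod q only for q >= 2; the standing hypothesis
   on m is [forall k, 2 <= m k]. *)
Definition vilenkin_space (m : nat -> nat) : Type :=
  prod_topology (fun k : nat => discrete_topology 'Z_(m k)).

HB.instance Definition _ (m : nat -> nat) :=
  Topological.copy (vilenkin_space m)
    (prod_topology (fun k : nat => discrete_topology 'Z_(m k))).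
HB.instance Definition _ (m : nat -> nat) :=
  isPointed.Build (vilenkin_space m) (fun k => 0 : 'Z_(m k)).

(* The group G_m with its Borel sigma-algebra. *)
Definition vilenkin (m : nat -> nat) : Type :=
  g_sigma_algebraType (@open (vilenkin_space m)).

HB.instance Definition _ (m : nat -> nat) :=
  Measurable.copy (vilenkin m) (g_sigma_algebraType (@open (vilenkin_space m))).

Section Vilenkin.
Context (R : realType) (m : nat -> nat).

Definition vadd (x y : vilenkin m) : vilenkin m :=
  fun k => x k + y k.

(* mu is already normalized, being a probability measure; on a compact
   metrizable group regularity is automatic, so translation invariance
   characterizes the normalized Haar measure. *)
Definition is_haar (mu : probability (vilenkin m) R) : Prop :=
  forall (a : vilenkin m) (A : set (vilenkin m)),
    measurable A -> mu (vadd a @` A) = mu A.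

(* The coset I_n(x). *)
Definition cyl (n : nat) (x : vilenkin m) : set (vilenkin m) :=
  [set y | forall k, (k < n)%N -> y k = x k].

Definition genM (n : nat) : nat := (\prod_(k < n) m k)%N.

Definition digit (n k : nat) : nat := ((n %/ genM k) %% m k)%N.

Definition rademacher (k : nat) (x : vilenkin m) : R[i] :=
  let t : R := 2 * pi * (x k)%:R / (m k)%:R in (cos t +i* sin t).

(* Since n < M_n, the digits n_k with k >= n vanish, so that the product over
   k < n is the whole infinite product. *)
Definition psi (n : nat) (x : vilenkin m) : R[i] :=
  \prod_(k < n) rademacher k x ^+ digit n k.

Variable mu : probability (vilenkin m) R.

Definition cintegrable (f : vilenkin m -> R[i]) : Prop :=
  mu.-integrable setT (fun x => (complex.Re (f x))%:E) /\
  mu.-integrable setT (fun x => (complex.Im (f x))%:E).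

Definition cintegral (f : vilenkin m -> R[i]) : R[i] :=
  (\int[mu]_x complex.Re (f x)) +i* (\int[mu]_x complex.Im (f x)).

Definition fourier (f : vilenkin m -> R[i]) (n : nat) : R[i] :=
  cintegral (fun x => f x * (psi n x)^*).

Definition psum (c : nat -> R[i]) (n : nat) (x : vilenkin m) : R[i] :=
  \sum_(k < n) c k * psi k x.

(* The sigma-algebra generated by the sets I_n(x). *)
Definition sigmaF (n : nat) : set (set (vilenkin m)) := <<s range (cyl n) >>.

Definition measurableF (n : nat) (f : vilenkin m -> R[i]) : Prop :=
  forall B : set R, measurable B ->
    sigmaF n [set x | B (complex.Re (f x))] /\
    sigmaF n [set x | B (complex.Im (f x))].

Definition is_martingale (f : nat -> vilenkin m -> R[i]) : Prop :=
  [/\ forall n, cintegrable (f n),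
      forall n, measurableF n (f n) &
      forall n l, (n <= l)%N -> psum (fourier (f l)) (genM n) = f n].

Definition martingale_max (f : nat -> vilenkin m -> R[i]) (x : vilenkin m) :
    \bar R :=
  ereal_sup (range (fun n => (normc (f n x))%:E)).

Definition hardy_norm (p : R) (f : nat -> vilenkin m -> R[i]) : \bar R :=
  'N[mu]_(p%:E)[martingale_max f].

Definition hardy (p : R) (f : nat -> vilenkin m -> R[i]) : Prop :=
  is_martingale f /\ (hardy_norm p f < +oo)%E.

(* The Fourier coefficients of a martingale; R[i]^o carries the norm topology. *)
Definition mfourier (f : nat -> vilenkin m -> R[i]) (i : nat) : R[i] :=
  limn (fun k => fourier (f k) i : R[i]^o).

Definition norlund_log (f : nat -> vilenkin m -> R[i]) (n : nat)
    (x : vilenkin m) : R[i] :=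
  (\sum_(1 <= k < n) k%:R^-1)^-1 *
  \sum_(1 <= k < n) psum (mfourier f) k x / (n - k)%:R.

(* The operator f |-> sup_(n >= 2) |L_n f| / w(n + 1). *)
Definition norlund_log_max (w : nat -> R) (f : nat -> vilenkin m -> R[i])
    (x : vilenkin m) : \bar R :=
  ereal_sup [set (normc (norlund_log f n x) / w n.+1)%:E
            | n in [set n | (2 <= n)%N]].

Definition bounded_hardy_L (p : R)
    (A : (nat -> vilenkin m -> R[i]) -> vilenkin m -> \bar R) : Prop :=
  exists C : R, forall f, hardy p f ->
    ('N[mu]_(p%:E)[A f] <= C%:E * hardy_norm p f)%E.

End Vilenkin.

(* Main.v *)
Require Import Defs.
From mathcomp Require Import all_boot all_order all_algebra.
From mathcomp Require Import complex.
From mathcomp Require Import all_classical all_reals all_analysis.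
From mathcomp Require Import measurable_realfun zify ring lra.

Import Order.TTheory GRing.Theory Num.Theory.
Import numFieldNormedType.Exports.

Local Open Scope classical_set_scope.
Local Open Scope ring_scope.

(* a) Each L_n f is a convex combination of the S_k f with k < n, so it suffices
   to dominate |S_k f| / (k+1)^(1/p-1).  The Dirichlet kernel satisfies
   |D_k(x - t)| <= B * sum_(j < N) M_j 1_(I_j(x))(t) for k < M_N, and f^(N) takes
   one value on each coset of measure 1 / M_N, so that the subadditivity of
   t |-> t^p gives, uniformly in k,
     (|S_k f(x)| / (k+1)^(1/p-1))^p <= B * sum_j M_j^p int_(I_j(x)) (f^* )^p.
   The right-hand side does not depend on k, and its integral is at most
   B * sum_j M_j^(p-1) * int (f^* )^p, a convergent geometric-type series.
   b) For f = D_(M_(N+1)) - D_(M_N) only S_(M_N+1) f = psi_(M_N) contributes to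
   L_(M_N+2) f, whence |L_(M_N+2) f| = 1 / l_(M_N+2) everywhere, while
   ||f||_(H_p) is at most a constant times M_N^(1-1/p). *)

(** * Mixed-radix digits and the numbering of cosets *)

Section Digits.
Local Set Implicit Arguments.
Local Unset Strict Implicit.
Local Open Scope nat_scope.
Context (m : nat -> nat) (m_ge2 : forall k, 2 <= m k).
Implicit Types (x y : vilenkin m) (k n v : nat).

Local Notation M := (genM m).

Lemma genM0 : M 0 = 1.
Proof. by rewrite /genM big_ord0. Qed.

Lemma genMS n : M n.+1 = m n * M n.
Proof. by rewrite /genM big_ord_recr /= mulnC. Qed.

Lemma m_gt0 k : 0 < m k.
Proof. exact: leq_trans (m_ge2 k). Qed.

Lemma genM_gt0 n : 0 < M n.
Proof. by elim: n => [|n ih]; rewrite ?genM0 // genMS muln_gt0 m_gt0. Qed.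

Lemma leq_exp2_genM n : 2 ^ n <= M n.
Proof.
by elim: n => [|n ih]; rewrite ?genM0 // genMS expnS leq_mul.
Qed.

Lemma ltn_genM n : n < M n.
Proof. exact: leq_trans (ltn_expl n (isT : 1 < 2)) (leq_exp2_genM n). Qed.

Lemma dvdn_genM k n : k <= n -> M k %| M n.
Proof.
move=> /subnKC <-; elim: (n - k) => [|d ih]; first by rewrite addn0.
by rewrite addnS genMS dvdn_mull.
Qed.

Lemma leq_genM k n : k <= n -> M k <= M n.
Proof. by move=> /dvdn_genM; apply: dvdn_leq; exact: genM_gt0. Qed.

Lemma ltn_digit v k : digit m v k < m k.
Proof. by rewrite /digit ltn_mod m_gt0. Qed.

Lemma digit_small n v k : v < M n -> n <= k -> digit m v k = 0.
Proof.
by move=> vn nk; rewrite /digit divn_small ?mod0n // (leq_trans vn) ?leq_genM.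
Qed.

(** [M n] is a multiple of [m k * M k], so after division by [M k] the leading block vanishes modulo
    [m k]. *)
Lemma digitMD_lt n a b k : k < n -> digit m (a * M n + b) k = digit m b k.
Proof.
move=> kn; have /dvdnP[c ->] := dvdn_genM kn.
rewrite /digit genMS !mulnA divnMDl ?genM_gt0 //.
by rewrite modnMDl.
Qed.

Lemma digitMD_eq n a b : a < m n -> b < M n -> digit m (a * M n + b) n = a.
Proof.
by move=> an bn; rewrite /digit divnMDl ?genM_gt0 // divn_small // addn0 modn_small.
Qed.

Lemma genM_recl n a b : a < m n -> b < M n -> a * M n + b < M n.+1.
Proof.
move=> an bn; rewrite genMS; apply: (@leq_trans (a.+1 * M n)).
  by rewrite mulSn addnC ltn_add2r.
by rewrite leq_mul2r an orbT.
Qed.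

(* The point of G_m whose coordinates are the digits of v, so that the cosets
   I_n(vrep v), v < M_n, partition G_m. *)
Definition vrep v : vilenkin m := fun k => inZp (digit m v k) : 'Z_(m k).

(** Reads the first [n] coordinates as a mixed-radix expansion, which numbers the cosets I_n by 0,
    ..., M_n - 1; [vrep] is the inverse numbering. *)
Fixpoint vindex n x : nat :=
  if n is n'.+1 then (x n' : nat) * M n' + vindex n' x else 0.

Lemma ltn_coord x k : (x k : nat) < m k.
Proof.
by rewrite -[X in _ < X](Zp_cast (m_ge2 k)); exact: (ltn_ord (x k : 'Z_(m k))).
Qed.

Lemma vrepE v k : vrep v k = digit m v k :> nat.
Proof. by rewrite /= Zp_cast // modn_small // ltn_digit. Qed.

Lemma ltn_vindex n x : vindex n x < M n.
Proof.
by elim: n => [|n ih]; [rewrite genM0 | apply: genM_recl => //; exact: ltn_coord].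
Qed.

Lemma digit_vindex n x k : k < n -> digit m (vindex n x) k = x k.
Proof.
elim: n => // n ih; rewrite ltnS leq_eqVlt => /orP[/eqP ->|kn] /=.
  by rewrite digitMD_eq ?ltn_coord ?ltn_vindex.
by rewrite digitMD_lt // ih.
Qed.

(** The coordinates below [n] are the digits of the index, so the index determines the coset. *)
Lemma cyl_vindexE n x y : cyl n x y <-> vindex n y = vindex n x.
Proof.
split=> [|e k kn]; last first.
  by apply/val_inj; rewrite /= -!(@digit_vindex n) // e.
elim: n => //= n ih yx; rewrite ih ?yx // => k kn.
by apply: yx; rewrite ltnS ltnW.
Qed.

Lemma vindexK n x : cyl n x (vrep (vindex n x)).
Proof. by move=> k kn; apply/val_inj; exact: etrans (vrepE _ _) (digit_vindex _ kn). Qed.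

Lemma vrepK n v : v < M n -> vindex n (vrep v) = v.
Proof.
elim: n v => [|n ih] v; first by rewrite genM0; case: v.
rewrite genMS => vM /=.
have dvn : digit m v n = v %/ M n.
  by rewrite /digit modn_small // ltn_divLR ?genM_gt0.
(* The induction hypothesis needs a number below [M n]; passing to the remainder keeps all digits
   below [n]. *)
have h : vindex n (vrep v) = vindex n (vrep (v %% M n)).
  apply/cyl_vindexE => k kn; apply/val_inj.
  apply: etrans (vrepE _ _) (etrans _ (esym (vrepE _ _))).
  by rewrite [in LHS](divn_eq v (M n)) digitMD_lt.
rewrite h ih ?ltn_mod ?genM_gt0 //.
have := vrepE v n; rewrite /= => ->.
by rewrite dvn -divn_eq.
Qed.

Lemma cyl_sym n x y : cyl n x y -> cyl n y x.
Proof. by move=> xy k kn; rewrite xy. Qed.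

Lemma cyl_trans n x y (z : vilenkin m) : cyl n x y -> cyl n y z -> cyl n x z.
Proof. by move=> xy yz k kn; rewrite yz ?xy. Qed.

Lemma cyl_le k n x y : k <= n -> cyl n x y -> cyl k x y.
Proof. by move=> kn xy i ik; apply: xy; exact: leq_trans kn. Qed.

Lemma cylS n x y : cyl n.+1 x y <-> cyl n x y /\ y n = x n.
Proof.
split=> [xy|[xy e] k]; first by split; [exact: cyl_le xy|exact: xy].
by rewrite ltnS leq_eqVlt => /orP[/eqP ->//|]; exact: xy.
Qed.

End Digits.

(** * Complex moduli and points of the unit circle *)

Section ComplexFacts.
Local Open Scope complex_scope.
Import ComplexField.Normc.
Context {R : realType}.
Implicit Types (a b : R) (z : R[i]).

Lemma normc_ge0 z : 0 <= normc z.
Proof. by case: z => a b; exact: sqrtr_ge0. Qed.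

Lemma normcX z n : normc (z ^+ n) = normc z ^+ n.
Proof.
by elim: n => [|n ih]; rewrite ?expr0 ?normc1 // !exprS normcM ih.
Qed.

Lemma conj_conjc z : Num.conj z = conjc z.
Proof. by []. Qed.

Lemma normcJ z : normc (Num.conj z) = normc z.
Proof. by rewrite conj_conjc; case: z => a b /=; rewrite sqrrN. Qed.

Lemma normc_real a : normc a%:C = `|a|.
Proof. by rewrite /= expr0n addr0 sqrtr_sqr. Qed.

Lemma normc_nat n : normc (n%:R : R[i]) = n%:R.
Proof. by rewrite -(rmorph_nat (real_complex R)) normc_real normr_nat. Qed.

Lemma le_normc_sum I (r : seq I) (P : pred I) (F : I -> R[i]) :
  normc (\sum_(i <- r | P i) F i) <= \sum_(i <- r | P i) normc (F i).
Proof.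
elim/big_ind2: _ => [|z1 a1 z2 a2 h1 h2|//]; first by rewrite normc0.
exact: le_trans (le_normcD _ _) (lerD h1 h2).
Qed.

(** The point e^(ia). *)
Definition cis a : R[i] := cos a +i* sin a.

Lemma cisD a b : cis a * cis b = cis (a + b).
Proof.
rewrite /cis cosD sinD; apply/eqP; rewrite eq_complex /= eqxx /=.
by rewrite addrC.
Qed.

Lemma cisJ a : Num.conj (cis a) = cis (- a).
Proof. by rewrite conj_conjc /cis cosN sinN. Qed.

Lemma cis0 : cis 0 = 1.
Proof. by rewrite /cis cos0 sin0. Qed.

Lemma cisX a n : cis a ^+ n = cis (n%:R * a).
Proof.
elim: n => [|n ih]; first by rewrite expr0 mul0r cis0.
by rewrite exprS ih cisD -natr1 mulrDl mul1r addrC.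
Qed.

Lemma cis_2pi n : cis (n%:R * (2 * pi)) = 1.
Proof.
by rewrite -cisX mulr_natl /cis cos2pi sin2pi expr1n.
Qed.

Lemma normc_cis a : normc (cis a) = 1.
Proof. by rewrite /cis /= cos2Dsin2 sqrtr1. Qed.

(** By 1 - cos a = 2 sin^2(|a|/2), where |a|/2 lies strictly between 0 and pi, so that the sine is
    positive. *)
Lemma cis_neq1 a : 0 < `|a| < 2 * pi -> cis a != 1.
Proof.
move=> /andP[a0 a2]; apply/negP => /eqP [/eqP + _].
have -> : cos a = 1 - (sin (`|a| / 2)) ^+ 2 *+ 2.
  rewrite -cos_norm {1}(_ : `|a| = (`|a| / 2) *+ 2); last first.
    by rewrite -mulr_natr divfK ?pnatr_eq0.
  by rewrite cos_mulr2n sin2cos2 mulrnBl opprB addrCA mulr2n -addrA addrCA opprD; ring.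
rewrite -subr_eq0 addrAC subrr sub0r oppr_eq0 mulrn_eq0 /= sqrf_eq0.
apply/negP; rewrite gt_eqF // sin_gt0_pi // divr_gt0 //=.
by rewrite ltr_pdivrMr // mulrC.
Qed.

End ComplexFacts.

(** * Characters and the Dirichlet kernel *)

Section Kernel.
Import ComplexField.Normc.
Local Set Implicit Arguments.
Local Unset Strict Implicit.
Context {R : realType} {m : nat -> nat} (m_ge2 : forall k, (2 <= m k)%N).
Implicit Types (x t : vilenkin m) (k n : nat).

Local Notation M := (genM m).
Local Notation psi := (@psi R m).
Local Notation rad := (@rademacher R m).

Lemma rademacherE k x : rad k x = cis (2 * pi * (x k)%:R / (m k)%:R).
Proof. by []. Qed.

Let m0 k : (m k)%:R != 0 :> R.
Proof. by rewrite pnatr_eq0 -lt0n m_gt0. Qed.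

Lemma rademacherX k x : rad k x ^+ m k = 1.
Proof.
rewrite rademacherE cisX -(cis_2pi (x k)); congr cis.
by field.
Qed.

(** If the coordinates differ, the angle 2 pi (x_k - t_k) / m_k is nonzero and less than a full
    turn, both coordinates lying in [0, m_k). *)
Lemma rademacher_sep k x t : rad k x * (rad k t)^* = 1 -> x k = t k.
Proof.
move=> h; apply/val_inj/eqP; apply: contraPT h => xt.
rewrite !rademacherE cisJ cisD => /eqP; apply/negP/cis_neq1.
rewrite -mulNr -mulrDl -mulrN -mulrDr normrM normfV normrM.
have p2 : 0 < 2 * pi :> R by rewrite mulr_gt0 // pi_gt0.
rewrite (gtr0_norm p2) normr_nat; apply/andP; split.
  rewrite divr_gt0 ?ltr0n ?m_gt0 // mulr_gt0 // normr_gt0 subr_eq0.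
  by rewrite eqr_nat.
rewrite ltr_pdivrMr ?ltr0n ?m_gt0 // ltr_pM2l // ltr_norml.
have := ltn_coord m_ge2 x k; have := ltn_coord m_ge2 t k.
rewrite -!(ltr_nat R) => h1 h2.
have := ler0n R (x k); have := ler0n R (t k) => h3 h4.
by apply/andP; split; lra.
Qed.

(** The digits of [i] from rank [n] on vanish, so the product may stop at any such [n] instead of at
    [i]; this gives the characters below [M n] a common range. *)
Lemma psiE n i x : (i < M n)%N -> psi i x = \prod_(k < n) rad k x ^+ digit m i k.
Proof.
have widen a b : (a <= b)%N -> (i < M a)%N ->
    \prod_(k < b) rad k x ^+ digit m i k = \prod_(k < a) rad k x ^+ digit m i k.
  move=> ab iM; rewrite (big_ord_widen b (fun k => rad k x ^+ digit m i k) ab).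
  rewrite [LHS](bigID (fun k : 'I_b => (k < a)%N)) /= [X in _ * X]big1 ?mulr1 //.
  by move=> k; rewrite -leqNgt => ak; rewrite (digit_small m_ge2 iM ak) expr0.
move=> iM; rewrite /psi.
case: (leqP i n) => [/widen <- //|/ltnW /widen ->//].
exact: ltn_genM.
Qed.

Lemma psiMD n a b x : (a < m n)%N -> (b < M n)%N ->
  psi (a * M n + b) x = rad n x ^+ a * psi b x.
Proof.
move=> am bM; rewrite (psiE x (genM_recl am bM)) // big_ord_recr /=.
rewrite digitMD_eq // mulrC (psiE x bM); congr (_ * _).
by apply: eq_bigr => k _; rewrite digitMD_lt.
Qed.

(* D_k(x - t), written without subtraction in G_m. *)
Definition dirichlet k x t : R[i] := \sum_(i < k) psi i x * (psi i t)^*.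

(** The last [b] indices share the digit [a] at rank [n], so their characters contribute the kernel
    D_b rotated by a phase. *)
Lemma dirichletMD n a b x t : (a < m n)%N -> (b <= M n)%N ->
  dirichlet (a * M n + b) x t = dirichlet (a * M n) x t +
    (rad n x * (rad n t)^*) ^+ a * dirichlet b x t.
Proof.
move=> am bM; rewrite /dirichlet big_split_ord /=; congr (_ + _).
rewrite mulr_sumr; apply: eq_bigr => i _.
have iM : (i < M n)%N := leq_trans (ltn_ord i) bM.
by rewrite !psiMD // rmorphM rmorphXn exprMn mulrACA.
Qed.

(** Each full block of length [M n] is the first one times a power of the phase, whence a geometric
    sum. *)
Lemma dirichletM n a x t : (a <= m n)%N ->
  dirichlet (a * M n) x t =
    (\sum_(j < a) (rad n x * (rad n t)^*) ^+ j) * dirichlet (M n) x t.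
Proof.
elim: a => [|a ih] am; first by rewrite mul0n /dirichlet !big_ord0 mul0r.
rewrite mulSnr dirichletMD // ih 1?ltnW // -mulrDl.
by rewrite big_ord_recr.
Qed.

Lemma rademacherJ k x : rad k x * (rad k x)^* = 1.
Proof. by rewrite rademacherE cisJ cisD subrr cis0. Qed.

(** Paley's formula. In the induction step the phase is an [m n]-th root of unity, whose geometric
    sum is [m n] if the coordinates of rank [n] agree and 0 otherwise. *)
Lemma dirichlet_genM n x t :
  dirichlet (M n) x t = if `[< cyl n x t >] then (M n)%:R else 0.
Proof.
elim: n => [|n ih].
  rewrite genM0 /dirichlet big_ord1 /psi !big_ord0 rmorph1 mulr1.
  by case: asboolP => // -[].
rewrite genMS dirichletM // ih.
case: (asboolP (cyl n x t)) => [xt|nxt]; last first.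
  by rewrite mulr0; case: asboolP => // /cylS[].
have [xtn|xtn] := eqVneq (t n) (x n).
  rewrite asboolT; last exact/cylS.
  rewrite !rademacherE xtn -rademacherE rademacherJ.
  under eq_bigr do rewrite expr1n.
  by rewrite sumr_const card_ord natrM.
rewrite asboolF; last by move=> /cylS[_ h]; rewrite h eqxx in xtn.
set w := rad n x * _; have w1 : w != 1.
  by apply: contraNneq xtn => /rademacher_sep ->.
suff -> : \sum_(j < m n) w ^+ j = 0 by rewrite mul0r.
(* Telescoping: (w - 1) times the sum is w^(m_n) - 1 = 0. *)
apply: (mulfI (x := w - 1)); first by rewrite subr_eq0.
rewrite mulr0 -subrX1 exprMn -rmorphXn /= !rademacherX.
by rewrite rmorph1 mulr1 subrr.
Qed.

Lemma normc_rademacherJ k x t : normc (rad k x * (rad k t)^*) = 1.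
Proof. by rewrite normcM normcJ !rademacherE !normc_cis mulr1. Qed.

(** Peeling off the leading digit leaves fewer than [B] full blocks, each equal to M_N 1_(I_N(x)) up
    to a phase, and the rotated kernel of the remainder modulo M_N. *)
Lemma normc_dirichlet_le (B : nat) N k x t : (forall j, m j <= B)%N -> (k < M N)%N ->
  normc (dirichlet k x t) <=
    \sum_(j < N) (B%:R * (M j)%:R) * (`[< cyl j x t >])%:R.
Proof.
move=> mB; elim: N k => [|N ih] k kM.
  move: kM; rewrite genM0 big_ord0; case: k => // _.
  by rewrite /dirichlet big_ord0 normc0.
rewrite big_ord_recr /= (divn_eq k (M N)).
have qm : (k %/ M N < m N)%N by rewrite ltn_divLR ?genM_gt0 // -genMS.
have rM : (k %% M N < M N)%N by rewrite ltn_mod genM_gt0.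
rewrite (dirichletMD _ _ qm (ltnW rM)) addrC.
apply: le_trans (le_normcD _ _) (lerD _ _); last first.
  by rewrite normcM normcX normc_rademacherJ expr1n mul1r ih.
rewrite (dirichletM _ _ (ltnW qm)) normcM dirichlet_genM -mulrA.
apply: ler_pM; rewrite ?normc_ge0 //; last first.
  by case: asboolP => _; rewrite ?mulr1 ?mulr0 ?normc0 // normc_nat.
apply: le_trans (le_normc_sum _ _ _ _) _.
under eq_bigr do rewrite normcX normc_rademacherJ expr1n.
by rewrite sumr_const card_ord ler_nat (leq_trans _ (mB N)) // ltnW.
Qed.

End Kernel.

(** * Cosets as measurable sets *)

Section Cylinders.
Local Set Implicit Arguments.
Local Unset Strict Implicit.
Context {R : realType} {m : nat -> nat} (m_ge2 : forall k, (2 <= m k)%N).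
Implicit Types (x y : vilenkin m) (k n v : nat).

Local Notation M := (genM m).

Lemma open_cyl n x : open (cyl n x : set (vilenkin_space m)).
Proof.
have -> : (cyl n x : set (vilenkin_space m)) =
    \big[setI/setT]_(k < n) (proj (k : nat) @^-1` [set x k]).
  by rewrite -(bigcap_mkord n (fun k => proj k @^-1` [set x k])).
apply: big_ind => [|A B oA oB|k _]; [exact: openT|exact: openI|].
apply: open_comp; last exact: discrete_open.
move=> y _.
exact: (@proj_continuous nat (fun k => discrete_topology 'Z_(m k)) k y).
Qed.

Lemma measurable_cyl n x : measurable (cyl n x).
Proof. by apply: sub_sigma_algebra; exact: open_cyl. Qed.

Lemma sigmaF_measurable n (A : set (vilenkin m)) : sigmaF n A -> measurable A.
Proof.
apply; split; first exact: sigma_algebra_measurable.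
by move=> _ [x _ <-]; exact: measurable_cyl.
Qed.

(** Pointwise form of F_n-measurability, F_n being generated by the finite partition into cosets of
    level [n]. *)
Definition cylconst (T : Type) n (f : vilenkin m -> T) :=
  forall x y, cyl n x y -> f y = f x.

Lemma cylconst_comp (S T : Type) n (g : S -> T) (f : vilenkin m -> S) :
  cylconst n f -> cylconst n (g \o f).
Proof. by move=> fn x y /fn /= ->. Qed.

Lemma cylconst_vrep (T : Type) n (f : vilenkin m -> T) x :
  cylconst n f -> f (vrep m (vindex n x)) = f x.
Proof. by move=> fn; apply: fn; exact: vindexK. Qed.

(** The preimage is the union of the cosets whose representative is sent into [B]; [v] ranges over
    all of [nat], which only repeats cosets. *)
Lemma sigmaF_preimage (T : Type) n (f : vilenkin m -> T) (B : set T) :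
  cylconst n f -> sigmaF n (f @^-1` B).
Proof.
move=> fn.
have -> : f @^-1` B = \bigcup_v
    (if `[< B (f (vrep m v)) >] then cyl n (vrep m v) else set0).
  rewrite eqEsubset; split=> [x /= Bx|x [v _]].
    exists (vindex n x) => //; rewrite cylconst_vrep // asboolT //.
    exact/cyl_sym/vindexK.
  by case: asboolP => // Bv /fn /= ->.
apply: sigma_algebra_bigcup => v; case: asboolP => _.
  by apply: sub_sigma_algebra; exists (vrep m v).
exact: sigma_algebra0.
Qed.

Lemma measurable_cylconst d (T : measurableType d) n (f : vilenkin m -> T) D :
  cylconst n f -> measurable_fun D f.
Proof.
move=> fn mD B mB; apply: measurableI => //.
exact: sigmaF_measurable (sigmaF_preimage _ fn).
Qed.

Lemma bigsetU_cyl n : \big[setU/set0]_(v < M n) cyl n (vrep m v) = setT.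
Proof.
apply/seteqP; split=> // x _; rewrite -(bigcup_mkord _ (fun v => cyl n (vrep m v))).
by exists (vindex n x); [exact: ltn_vindex|exact/cyl_sym/vindexK].
Qed.

Lemma trivIset_cyl n : trivIset setT (fun v : 'I_(M n) => cyl n (vrep m v)).
Proof.
move=> v w _ _ [x [/cyl_sym xv /cyl_sym xw]]; apply/val_inj => /=.
move/(cyl_vindexE m_ge2): xv; move/(cyl_vindexE m_ge2): xw.
by rewrite !vrepK // => -> ->.
Qed.

Lemma cyl_eq_vrep n x v : (v < M n)%N -> `[< cyl n x (vrep m v) >] = (v == vindex n x).
Proof.
move=> vM; apply/asboolP/eqP => [/(cyl_vindexE m_ge2)|->]; last exact: vindexK.
by rewrite vrepK.
Qed.

(** * Haar measure of cosets and integrals of coset-constant functions *)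

Section Measure.
Context (mu : probability (vilenkin m) R) (mu_haar : is_haar mu).

(** Translation by y - x carries the first coset onto the second. *)
Lemma haar_cyl_eq n x y : mu (cyl n x) = mu (cyl n y).
Proof.
pose a : vilenkin m := fun k => (y k : 'Z_(m k)) - x k.
rewrite -(mu_haar a (measurable_cyl n x)); congr (mu _).
apply/seteqP; split=> [_ [z xz <-] k kn|z yz].
  by rewrite /vadd /a xz // subrK.
exists (fun k => (z k : 'Z_(m k)) - a k); last first.
  by apply: functional_extensionality_dep => k; rewrite /vadd addrC subrK.
by move=> k kn; rewrite /a yz // opprB addrC subrK.
Qed.

(** The M_n cosets of level [n] are disjoint, have equal measure and cover a space of measure 1. *)
Lemma haar_cyl n x : mu (cyl n x) = ((M n)%:R^-1)%:E.
Proof.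
have h : (\sum_(v < M n) mu (cyl n (vrep m v)) = 1)%E.
  rewrite -measure_bigsetU_ord; last exact: trivIset_cyl.
    by rewrite bigsetU_cyl; exact: (@probability_setT _ _ _ mu).
  by move=> v; exact: measurable_cyl.
have fx : mu (cyl n x) \is a fin_num by rewrite fin_num_measure //; exact: measurable_cyl.
have M0 : (M n)%:R != 0 :> R by rewrite pnatr_eq0 -lt0n genM_gt0.
move: h; under eq_bigr do rewrite (haar_cyl_eq _ _ x).
rewrite -(fineK fx) sumEFin => -[]; rewrite sumr_const card_ord => h.
by congr EFin; apply: (mulfI M0); rewrite mulfV // mulr_natl.
Qed.

Lemma ge0_integral_cyl n (f : vilenkin m -> \bar R) :
  measurable_fun [set: vilenkin m] f -> (forall x, 0 <= f x)%E ->
  (\int[mu]_x f x = \sum_(v < M n) \int[mu]_(x in cyl n (vrep m v)) f x)%E.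
Proof.
move=> mf f0; rewrite -(bigsetU_cyl n).
rewrite (@ge0_integral_bigsetU _ _ _ mu _ (fun v : 'I_(M n) => cyl n (vrep m v))) //.
- by move=> v; exact: measurable_cyl.
- exact: index_enum_uniq.
- by apply: sub_trivIset (@trivIset_cyl n).
- by rewrite bigsetU_cyl.
Qed.

Lemma integral_cylconst n (f : vilenkin m -> \bar R) x :
  cylconst n f -> (\int[mu]_(y in cyl n x) f y = f x * ((M n)%:R^-1)%:E)%E.
Proof.
move=> fn; rewrite (eq_integral (cst (f x))).
  rewrite integral_cst; last exact: measurable_cyl.
  by congr (_ * _)%E; exact: haar_cyl.
by move=> y; rewrite inE => /fn.
Qed.

Lemma ge0_integral_cylconst n (f : vilenkin m -> \bar R) :
  cylconst n f -> (forall x, 0 <= f x)%E ->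
  (\int[mu]_x f x = \sum_(v < M n) f (vrep m v) * ((M n)%:R^-1)%:E)%E.
Proof.
move=> fn f0; rewrite (ge0_integral_cyl n) //; last exact: measurable_cylconst fn.
by apply: eq_bigr => v _; exact: integral_cylconst.
Qed.

(** Exhibits [f] as a simple function, which yields integrability and a finite-sum integral for
    functions of any sign. *)
Lemma cylconstE n (f : vilenkin m -> R) x : cylconst n f ->
  f x = \sum_(v < M n) f (vrep m v) * \1_(cyl n (vrep m v)) x.
Proof.
move=> fn; rewrite (bigD1 (Ordinal (ltn_vindex m_ge2 n x))) //= big1 ?addr0.
  by rewrite cylconst_vrep // indicE mem_set ?mulr1 //; exact/cyl_sym/vindexK.
move=> v /eqP vx; rewrite indicE memNset ?mulr0 // => /cyl_sym/(cyl_vindexE m_ge2).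
by rewrite vrepK // => h; apply: vx; exact/val_inj.
Qed.

Lemma integrable_cylconst n (f : vilenkin m -> R) :
  cylconst n f -> mu.-integrable [set: vilenkin m] (EFin \o f).
Proof.
move=> fn.
have -> : EFin \o f = (fun x => \sum_(v < M n)
    (f (vrep m v))%:E * (\1_(cyl n (vrep m v)) x)%:E)%E.
  by apply/funext => x; rewrite /= (cylconstE _ fn) -sumEFin.
apply: integrable_sum => // v _; apply: integrableZl => //.
by apply: integrable_indic; exact: measurable_cyl.
Qed.

Lemma Rintegral_cylconst n (f : vilenkin m -> R) : cylconst n f ->
  \int[mu]_x f x = (M n)%:R^-1 * \sum_(v < M n) f (vrep m v).
Proof.
move=> fn; rewrite /Rintegral.
under eq_integral do rewrite (cylconstE _ fn) -sumEFin.
rewrite integral_sum //; last first.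
  move=> v; apply: (@integrableZl _ _ _ mu _ measurableT _ (fun x => (\1_(cyl n (vrep m v)) x)%:E)).
  by apply: integrable_indic; exact: measurable_cyl.
rewrite (eq_bigr (fun v : 'I_(M n) => (f (vrep m v) * (M n)%:R^-1)%:E)).
  by rewrite sumEFin /= -mulr_suml mulrC.
move=> v _; under eq_integral do rewrite EFinM.
rewrite integralZl //; last by apply: integrable_indic; exact: measurable_cyl.
rewrite integral_indic ?setIT //; last exact: measurable_cyl.
by rewrite EFinM; congr (_ * _)%E; exact: haar_cyl.
Qed.

End Measure.
End Cylinders.

(** * Fourier coefficients as finite sums *)

Section FourierCoefficients.
Local Set Implicit Arguments.
Local Unset Strict Implicit.
Import ComplexField.Normc.
Context {R : realType} {m : nat -> nat} (m_ge2 : forall k, (2 <= m k)%N).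
Context (mu : probability (vilenkin m) R) (mu_haar : is_haar mu).
Implicit Types (x y : vilenkin m) (i k n v : nat) (c : nat -> R[i]).

Local Notation M := (genM m).
Local Notation psi := (@psi R m).
Local Notation psum := (@psum R m).

Lemma Re_sum I (r : seq I) (F : I -> R[i]) :
  complex.Re (\sum_(i <- r) F i) = \sum_(i <- r) complex.Re (F i).
Proof. by apply: big_morph => // -[a b] [a' b']. Qed.

Lemma Im_sum I (r : seq I) (F : I -> R[i]) :
  complex.Im (\sum_(i <- r) F i) = \sum_(i <- r) complex.Im (F i).
Proof. by apply: big_morph => // -[a b] [a' b']. Qed.

Let Mneq0 n : (M n)%:R != 0 :> R[i].
Proof. by rewrite pnatr_eq0 -lt0n genM_gt0. Qed.

Lemma cintegral_cylconst n (f : vilenkin m -> R[i]) : cylconst n f ->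
  cintegral mu f = (M n)%:R^-1 * \sum_(v < M n) f (vrep m v).
Proof.
move=> fn; rewrite /cintegral (Rintegral_cylconst m_ge2 mu_haar (n := n)); last first.
  exact: (cylconst_comp (@complex.Re R) fn).
rewrite (Rintegral_cylconst m_ge2 mu_haar (n := n)); last first.
  exact: (cylconst_comp (@complex.Im R) fn).
rewrite -Re_sum -Im_sum; move: (\sum_(_ < _) _) => -[a b].
rewrite -(rmorph_nat (real_complex R)) -fmorphV /=.
by apply/eqP; rewrite eq_complex /= !mul0r subr0 addr0 !eqxx.
Qed.

Lemma cintegrable_cylconst n (f : vilenkin m -> R[i]) :
  cylconst n f -> cintegrable mu f.
Proof.
move=> fn; split; apply: (integrable_cylconst m_ge2 mu (n := n)).
  exact: (cylconst_comp (@complex.Re R) fn).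
exact: (cylconst_comp (@complex.Im R) fn).
Qed.

Lemma cylconst_psi n i : (i < M n)%N -> cylconst n (psi i).
Proof.
move=> iM x y xy; rewrite !(psiE m_ge2 _ iM); apply: eq_bigr => k _.
by rewrite /rademacher xy.
Qed.

Lemma cylconst_psum n c k : (k <= M n)%N -> cylconst n (psum c k).
Proof.
move=> kM x y xy; rewrite /psum; apply: eq_bigr => i _.
by rewrite (cylconst_psi _ xy) // (leq_trans (ltn_ord i)).
Qed.

(* The square matrix [psi k (vrep v)] has a right inverse by [dirichlet_genM];
   that it is also a left inverse is the orthonormality. *)
Lemma psi_orthonormal n i j : (i < M n)%N -> (j < M n)%N ->
  (M n)%:R^-1 * \sum_(v < M n) psi j (vrep m v) * (psi i (vrep m v))^* = (i == j)%:R.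
Proof.
move=> iM jM.
pose A : 'M[R[i]]_(M n) := \matrix_(v, k) psi k (vrep m v).
pose B : 'M[R[i]]_(M n) := \matrix_(k, v) ((M n)%:R^-1 * (psi k (vrep m v))^*).
have AB : A *m B = 1%:M.
  apply/matrixP => v w; rewrite !mxE.
  under eq_bigr do rewrite !mxE mulrCA.
  rewrite -mulr_sumr -/(dirichlet (M n) (vrep m v) (vrep m w)) dirichlet_genM //.
  rewrite cyl_eq_vrep // vrepK // -val_eqE /= eq_sym.
  by case: (_ == _); rewrite ?mulVf ?mulr0.
have /matrixP/(_ (Ordinal iM) (Ordinal jM)) := mulmx1C AB.
rewrite !mxE => <-; rewrite mulr_sumr; apply: eq_bigr => v _.
by rewrite !mxE /= mulrA mulrAC.
Qed.

Lemma fourierE n (f : vilenkin m -> R[i]) i : cylconst n f -> (i < M n)%N ->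
  fourier mu f i = (M n)%:R^-1 * \sum_(v < M n) f (vrep m v) * (psi i (vrep m v))^*.
Proof.
move=> fn iM.
have fpsi : cylconst n (fun x => f x * (psi i x)^*).
  by move=> x y xy; rewrite (fn _ _ xy) (cylconst_psi iM xy).
exact: cintegral_cylconst fpsi.
Qed.

(** After exchanging the two sums, orthonormality leaves only the index [i]. *)
Lemma fourier_psum n c i : (i < M n)%N -> fourier mu (psum c (M n)) i = c i.
Proof.
move=> iM; rewrite (fourierE (cylconst_psum c (leqnn (M n))) iM).
under eq_bigr do rewrite /psum mulr_suml.
rewrite exchange_big mulr_sumr (bigD1 (Ordinal iM)) //= [X in _ + X]big1 ?addr0.
  under eq_bigr do rewrite -mulrA.
  by rewrite -mulr_sumr mulrCA psi_orthonormal // eqxx mulr1.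
move=> j ji; under eq_bigr do rewrite -mulrA.
rewrite -mulr_sumr mulrCA psi_orthonormal // eq_sym.
by rewrite (_ : (j == i :> nat) = false) ?mulr0 //; exact/negbTE.
Qed.

Lemma eq_psum n k c c' x : (k <= n)%N -> (forall i, (i < n)%N -> c i = c' i) ->
  psum c k x = psum c' k x.
Proof.
by move=> kn cc'; apply: eq_bigr => i _; rewrite cc' // (leq_trans (ltn_ord i)).
Qed.

(** * Coefficients and partial sums of martingales *)

Section Martingales.
Context (f : nat -> vilenkin m -> R[i]) (f_mart : is_martingale mu f).

(** The martingale identity with [l = n] makes [f n] a combination of characters of index below
    [M n]. *)
Lemma cylconst_martingale n : cylconst n (f n).
Proof.
by case: f_mart => _ _ /(_ n n (leqnn n)) <-; exact: cylconst_psum.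
Qed.

Lemma fourier_martingale n l i : (n <= l)%N -> (i < M n)%N ->
  fourier mu (f l) i = fourier mu (f n) i.
Proof.
by case: f_mart => _ _ h /h <- iM; rewrite fourier_psum.
Qed.

(** The coefficients of index [i] are constant from rank [n] on, so the limit is already attained
    there. *)
Lemma mfourier_martingale n i : (i < M n)%N -> mfourier mu f i = fourier mu (f n) i.
Proof.
move=> iM; rewrite /mfourier; apply: (@lim_near_cst R[i]^o) => //.
by near=> l; apply: fourier_martingale => //; near: l; exact: nbhs_infty_ge.
Unshelve. all: by end_near. Qed.

(** The convolution of f^(n) with the kernel D_k; both are constant on cosets of level [n], so the
    integral is an average over representatives. *)
Lemma psum_martingale n k x : (k <= M n)%N -> psum (mfourier mu f) k x =
  (M n)%:R^-1 * \sum_(v < M n) f n (vrep m v) * dirichlet k x (vrep m v).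
Proof.
move=> kM; rewrite /psum.
under eq_bigr => i _ do rewrite (mfourier_martingale (leq_trans (ltn_ord i) kM))
  (fourierE (@cylconst_martingale n) (leq_trans (ltn_ord i) kM)) -mulrA mulr_suml.
rewrite -mulr_sumr exchange_big; congr (_ * _); apply: eq_bigr => v _ /=.
rewrite /dirichlet mulr_sumr; apply: eq_bigr => i _.
by rewrite -mulrA; congr (_ * _); exact: mulrC.
Qed.

End Martingales.

(** Each [psum c (M n)] has the coefficients [c] below [M n], so the levels are compatible; the test
    martingales of part b) arise this way. *)
Lemma is_martingale_psum c : is_martingale mu (fun n => psum c (M n)).
Proof.
have cc n : cylconst n (psum c (M n)) by exact: cylconst_psum.
split=> [n|n B _|n l nl]; first exact: cintegrable_cylconst (cc n).
  split; rewrite -[X in sigmaF n X]/((_ \o psum c (M n)) @^-1` B).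
    exact: sigmaF_preimage (cylconst_comp _ (cc n)).
  exact: sigmaF_preimage (cylconst_comp _ (cc n)).
apply/funext => x; apply: eq_psum (leqnn _) _ => i iM.
by rewrite fourier_psum // (leq_trans iM) // leq_genM.
Qed.

Lemma mfourier_psum c i : mfourier mu (fun n => psum c (M n)) i = c i.
Proof.
rewrite (mfourier_martingale (is_martingale_psum c) (n := i)) ?fourier_psum //.
  exact: ltn_genM.
exact: ltn_genM.
Qed.

End FourierCoefficients.

(** * Subadditivity of powers with exponent at most 1 *)

Section RealPowers.
Local Set Implicit Arguments.
Local Unset Strict Implicit.
Context {R : realType}.
Implicit Types (a p : R).

(** After division by the sum [s] every term lies in [0, 1], where t <= t^p, and the normalized
    terms add up to 1. *)
Lemma powR_sum_le (I : finType) (P : pred I) (a : I -> R) p : 0 < p -> p <= 1 ->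
  (forall i, P i -> 0 <= a i) ->
  (\sum_(i | P i) a i) `^ p <= \sum_(i | P i) a i `^ p.
Proof.
move=> p0 p1 a0; set s := \sum_(i | P i) a i.
have : 0 <= s by apply: sumr_ge0 => i Pi; exact: a0.
rewrite le_eqVlt => /predU1P[<-|s0].
  by rewrite powR0 ?gt_eqF // sumr_ge0 // => i _; exact: powR_ge0.
have -> : s `^ p = \sum_(i | P i) (a i / s) * s `^ p.
  by rewrite -mulr_suml -mulr_suml divff ?mul1r // gt_eqF.
apply: ler_sum => i Pi; have /predU1P[<-|ai0] : (0 == a i) || (0 < a i).
- by rewrite -le_eqVlt a0.
- by rewrite !mul0r powR_ge0.
- have -> : a i `^ p = (a i / s) `^ p * s `^ p.
    by rewrite -powRM ?divfK ?gt_eqF // ltW // divr_gt0.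
  rewrite ler_wpM2r ?powR_ge0 // ger1_powR //.
  rewrite divr_gt0 //= ler_pdivrMr // mul1r /s (bigD1 i) //= lerDl.
  by rewrite sumr_ge0 // => j /andP[Pj _]; exact: a0.
Qed.

End RealPowers.

(** * Logarithmic means as convex combinations *)

Section LogarithmicMeans.
Local Set Implicit Arguments.
Local Unset Strict Implicit.
Import ComplexField.Normc.
Context {R : realType} {m : nat -> nat}.
Context (mu : probability (vilenkin m) R).
Implicit Types (f : nat -> vilenkin m -> R[i]).

Definition log_weight n : R := \sum_(1 <= k < n) k%:R^-1.

Lemma log_weight_gt0 n : (2 <= n)%N -> 0 < log_weight n.
Proof.
case: n => [|[|n]] // _; rewrite /log_weight big_nat_recl // invr1.
by rewrite ltr_pwDl // sumr_ge0 // => i _; rewrite invr_ge0.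
Qed.

Lemma norlund_logE f n x : norlund_log mu f n x =
  (real_complex R (log_weight n))^-1 *
  \sum_(1 <= k < n) psum (mfourier mu f) k x / (n - k)%:R.
Proof.
rewrite /norlund_log /log_weight rmorph_sum; congr (_^-1 * _).
by apply: eq_bigr => k _; rewrite fmorphV rmorph_nat.
Qed.

Lemma normc_norlund_log_le f n x (Y : R) : (2 <= n)%N ->
  (forall k, (1 <= k < n)%N -> normc (psum (mfourier mu f) k x) <= Y) ->
  normc (norlund_log mu f n x) <= Y.
Proof.
move=> n2 fY; have l0 := log_weight_gt0 n2.
rewrite norlund_logE normcM normcV normc_real gtr0_norm //.
rewrite mulrC ler_pdivrMr //.
apply: le_trans (le_normc_sum _ _ _ _) _.
apply: (@le_trans _ _ (\sum_(1 <= k < n) Y / (n - k)%:R)).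
  rewrite big_nat_cond [leRHS]big_nat_cond; apply: ler_sum => k; rewrite andbT => kn.
  by rewrite normcM normcV normc_nat ler_wpM2r ?invr_ge0 // fY.
(* The reflection k -> n - k turns the weights 1 / (n - k) into the terms 1 / k of l_n. *)
rewrite /log_weight mulr_sumr big_nat_rev /= big_nat_cond [leRHS]big_nat_cond.
apply: ler_sum => k /andP[/andP[k1 kn] _].
by have -> : (n - (1 + n - k.+1) = k)%N by lia.
Qed.

End LogarithmicMeans.

(** * Pointwise majorant of the maximal operator and its integral *)

Section UpperBound.
Local Set Implicit Arguments.
Local Unset Strict Implicit.
Import ComplexField.Normc.
Context {R : realType} {m : nat -> nat} (m_ge2 : forall k, (2 <= m k)%N).
Context (B : nat) (m_le : forall k, (m k <= B)%N).
Context (mu : probability (vilenkin m) R) (mu_haar : is_haar mu).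
Context (p : R) (p_gt0 : 0 < p) (p_lt1 : p < 1).
Context (f : nat -> vilenkin m -> R[i]) (f_mart : is_martingale mu f).
Implicit Types (x y : vilenkin m) (i j k n v : nat).

Local Notation M := (genM m).

Let M_gt0 n : 0 < (M n)%:R :> R.
Proof. by rewrite ltr0n genM_gt0. Qed.

Let B_gt0 : 0 < B%:R :> R.
Proof. by rewrite ltr0n (leq_trans (m_gt0 m_ge2 0)). Qed.

(** For [j <= N], the integral of |f^(N)|^p over I_j(x) as an average over the cosets of level
    [N]. *)
Definition level_mass N j x : R := (M N)%:R^-1 *
  \sum_(v < M N) normc (f N (vrep m v)) `^ p * (`[< cyl j x (vrep m v) >])%:R.

(* The sum over the [M N] cosets turns [t `^ p], subadditive for [p <= 1], into
   an L^p quantity at the cost of the factor [(M N) `^ (1 - p)], which the weight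
   [(n + 1) `^ (p^-1 - 1)] of the maximal operator absorbs. *)
Lemma powR_psum_le N k x : (k < M N)%N ->
  normc (psum (mfourier mu f) k x) `^ p <=
    B%:R `^ p * (M N)%:R `^ (1 - p) *
    \sum_(j < N) (M j)%:R `^ p * level_mass N j x.
Proof.
move=> kM; rewrite (psum_martingale m_ge2 mu_haar f_mart x (ltnW kM)).
rewrite normcM normcV normc_nat.
pose a (v j : nat) := normc (f N (vrep m v)) * ((B%:R * (M j)%:R) * (`[< cyl j x (vrep m v) >])%:R).
have a0 v j : 0 <= a v j by rewrite !mulr_ge0 ?normc_ge0.
apply: (@le_trans _ _ (((M N)%:R^-1 * \sum_(v < M N) \sum_(j < N) a v j) `^ p)).
  apply: ge0_ler_powR; rewrite ?nnegrE ?(ltW p_gt0) ?mulr_ge0 ?invr_ge0 ?normc_ge0 //.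
    by apply: sumr_ge0 => v _; apply: sumr_ge0.
  rewrite ler_pM2l ?invr_gt0 //.
  apply: le_trans (le_normc_sum _ _ _ _) (ler_sum _ _) => v _.
  rewrite normcM /a -mulr_sumr ler_wpM2l ?normc_ge0 //.
  exact: normc_dirichlet_le.
rewrite powRM ?invr_ge0 //; last by apply: sumr_ge0 => v _; apply: sumr_ge0.
rewrite pair_bigA /=.
apply: (@le_trans _ _ ((M N)%:R^-1 `^ p * \sum_(q : 'I_(M N) * 'I_N) a q.1 q.2 `^ p)).
  rewrite ler_wpM2l ?powR_ge0 //; apply: powR_sum_le => //; exact: ltW.
rewrite -(pair_bigA _ (fun (v : 'I_(M N)) (j : 'I_N) => a v j `^ p)) /= exchange_big /=.
rewrite !mulr_sumr; apply: ler_sum => j _.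
rewrite /level_mass !mulr_sumr; apply: ler_sum => v _.
have h (b : bool) : b%:R `^ p = b%:R :> R.
  by case: b; rewrite ?powR1 // powR0 // gt_eqF.
rewrite /a !powRM ?mulr_ge0 ?normc_ge0 // h.
have -> : (M N)%:R `^ (1 - p) = (M N)%:R / (M N)%:R `^ p :> R.
  by rewrite powRB ?powRr1 //; apply/implyP => _; rewrite gt_eqF.
have -> : (M N)%:R^-1 `^ p = ((M N)%:R `^ p)^-1 :> R.
  by rewrite -powR_inv1 // powRAC powR_inv1 // powR_ge0.
rewrite le_eqVlt; apply/orP; left; apply/eqP.
have : (M N)%:R != 0 :> R by rewrite gt_eqF.
have : (M N)%:R `^ p != 0 :> R by rewrite gt_eqF // powR_gt0.
move: ((M N)%:R `^ p) => u u0 w0.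
by field; rewrite u0 w0.
Qed.

Local Open Scope ereal_scope.

(** The integrand of the p-th power of the H_p quasi-norm, in the form to which ['N[mu]_p]
    unfolds. *)
Definition max_pow x : \bar R := `|martingale_max f x| `^ p.

Lemma measurable_martingale_max : measurable_fun [set: vilenkin m] (martingale_max f).
Proof.
have mf n : measurable_fun [set: vilenkin m] (fun x => (normc (f n x))%:E).
  apply: (measurable_cylconst m_ge2 (n := n)).
  apply: (cylconst_comp (fun z => (normc z)%:E)).
  exact: (cylconst_martingale m_ge2 f_mart).
have -> : martingale_max f = fun x => esups (fun n => (normc (f n x))%:E) 0%N.
  apply/funext => x; congr ereal_sup.
  by apply/seteqP; split=> _ [n _ <-]; exists n.
exact: measurable_fun_esups.
Qed.

Lemma measurable_max_pow : measurable_fun [set: vilenkin m] max_pow.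
Proof.
apply: (measurableT_comp (measurable_poweR p)).
by apply: measurableT_comp => //; exact: measurable_martingale_max.
Qed.

Lemma max_pow_ge0 x : 0 <= max_pow x.
Proof. exact: poweR_ge0. Qed.

Lemma le_max_pow n x : (normc (f n x) `^ p)%:E <= max_pow x.
Proof.
rewrite -poweR_EFin; apply: gt0_ler_poweR; rewrite ?(ltW p_gt0) //.
- by rewrite in_itv /= lee_fin normc_ge0 leey.
- by rewrite in_itv /= abse_ge0 leey.
apply: le_trans (lee_abs _); apply: ereal_sup_ubound.
by exists n.
Qed.

Lemma level_mass_le N j x : (j <= N)%N ->
  (level_mass N j x)%:E <= \int[mu]_(y in cyl j x) max_pow y.
Proof.
move=> jN.
(* As [j <= N], the indicator of I_j(x) is constant on cosets of level [N], so [level_mass] is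
   exactly the integral of [g]. *)
pose g y := ((normc (f N y) `^ p) * (`[< cyl j x y >])%:R)%:E.
have gN : cylconst N g.
  move=> y z yz; rewrite /g (cylconst_martingale m_ge2 f_mart yz).
  congr ((_ * _%:R)%:E); congr nat_of_bool; apply: asbool_equiv_eq.
  have yzj := cyl_le jN yz.
  by split=> xy; apply: cyl_trans xy _ => //; exact: cyl_sym.
have g0 y : 0 <= g y by rewrite lee_fin mulr_ge0 ?powR_ge0.
have -> : (level_mass N j x)%:E = \int[mu]_y g y.
  rewrite (ge0_integral_cylconst m_ge2 mu_haar gN g0) /g.
  by under [RHS]eq_bigr do rewrite -EFinM; rewrite sumEFin -mulr_suml mulrC.
rewrite [leRHS]integral_mkcond; apply: ge0_le_integral => //.
- exact: measurable_cylconst gN.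
- apply/(measurable_restrictT _ _).1; first exact: measurable_cyl.
  exact: measurable_funS measurable_max_pow.
- move=> y _; rewrite /g patchE; case: asboolP => xy.
    by rewrite mem_set // mulr1; exact: le_max_pow.
  by rewrite memNset // mulr0.
Qed.

Definition majorant x : \bar R :=
  \sum_(j <oo) ((M j)%:R `^ p)%:E * \int[mu]_(y in cyl j x) max_pow y.

Lemma local_max_ge0 j x :
  0 <= ((M j)%:R `^ p)%:E * \int[mu]_(y in cyl j x) max_pow y.
Proof.
apply: mule_ge0; first by rewrite lee_fin powR_ge0.
by apply: integral_ge0 => y _; exact: max_pow_ge0.
Qed.

Lemma majorant_ge0 x : 0 <= majorant x.
Proof. by apply: nneseries_ge0 => j _ _; exact: local_max_ge0. Qed.

Lemma powR_psum_majorant k x : (1 <= k)%N ->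
  (normc (psum (mfourier mu f) k x) `^ p)%:E <=
    (B%:R * k.+1%:R `^ (1 - p))%:E * majorant x.
Proof.
move=> k1.
(* The level with M_N <= k < M_(N+1), whence M_(N+1) <= B (k + 1); [k >= 1] excludes the minimal
   index 0, since M_0 = 1. *)
have [N kN Nk] : exists2 N, (k < M N.+1)%N & (M N <= k)%N.
  have ex : exists N, (k < M N)%N by exists k; exact: ltn_genM.
  case: (ex_minnP ex) => -[|N]; first by rewrite genM0 ltnS leqn0 => /eqP k0; rewrite k0 in k1.
  move=> kN min; exists N => //; rewrite leqNgt; apply/negP => /min.
  by rewrite ltnn.
apply: (@le_trans _ _ ((B%:R * k.+1%:R `^ (1 - p))%:E *
    (\sum_(j < N.+1) (M j)%:R `^ p * level_mass N.+1 j x)%:E)).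
  rewrite -EFinM lee_fin; apply: le_trans (powR_psum_le x kN) _.
  rewrite ler_wpM2r //.
    apply: sumr_ge0 => j _; rewrite mulr_ge0 ?powR_ge0 // /level_mass mulr_ge0 ?invr_ge0 //.
    by apply: sumr_ge0 => v _; rewrite mulr_ge0 ?powR_ge0.
  (* B^p comes from the kernel bound and B^(1-p) from M_(N+1)^(1-p). *)
  have BE : (B%:R `^ p * B%:R `^ (1 - p) = B%:R :> R)%R.
    rewrite -powRD; first by rewrite addrC subrK powRr1.
    by apply/implyP => _; rewrite gt_eqF.
  rewrite -[X in (_ <= X * _)%R]BE -mulrA ler_wpM2l ?powR_ge0 // -powRM // ge0_ler_powR ?nnegrE //.
    by rewrite subr_ge0 ltW.
  rewrite -natrM ler_nat genMS leq_mul // ltnW //.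
apply: lee_wpmul2l; first by rewrite lee_fin mulr_ge0 ?powR_ge0.
apply: (@le_trans _ _ (\sum_(j < N.+1) ((M j)%:R `^ p)%:E * \int[mu]_(y in cyl j x) max_pow y)).
  rewrite -sumEFin; apply: lee_sum => j _; rewrite EFinM.
  by apply: lee_wpmul2l; [rewrite lee_fin powR_ge0|apply: level_mass_le; exact: ltnW].
rewrite -(big_mkord xpredT (fun j => ((M j)%:R `^ p)%:E * \int[mu]_(y in cyl j x) max_pow y)).
by apply: nneseries_lim_ge => j _ _; exact: local_max_ge0.
Qed.

Lemma norlund_log_max_majorant x :
  `|norlund_log_max mu (fun n => n%:R `^ (p^-1 - 1))%R f x| `^ p <= B%:R%:E * majorant x.
Proof.
have := majorant_ge0 x; have := fun k => @powR_psum_majorant k x.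
(* An infinite majorant makes the bound trivial because B > 0; the value -oo contradicts
   nonnegativity. *)
case: (majorant x) => [g hg|_ _|//]; last first.
  by rewrite gt0_muley ?leey // lte_fin.
rewrite lee_fin => g0.
have pV : (p * p^-1 = 1)%R by rewrite mulfV // gt_eqF.
have le_sup : norlund_log_max mu (fun n => n%:R `^ (p^-1 - 1))%R f x <=
    ((B%:R * g) `^ p^-1)%:E.
  apply: ge_ereal_sup => _ [n n2 <-]; rewrite lee_fin.
  rewrite ler_pdivrMr; last by rewrite powR_gt0.
  apply: normc_norlund_log_le => // k /andP[k1 kn].
  have := hg _ k1; rewrite -EFinM lee_fin => h.
  rewrite -[leLHS]powRr1 ?normc_ge0 // -[in leLHS]pV powRrM /=.
  (* With |S_k f| written as (|S_k f|^p)^(1/p), the weight must also be a 1/p-th power for the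
     estimates to be compared inside it. *)
  have -> : (n.+1%:R `^ (p^-1 - 1) = (n.+1%:R `^ (1 - p)) `^ p^-1 :> R)%R.
    by rewrite -powRrM mulrBl pV mul1r.
  rewrite -powRM ?powR_ge0 ?mulr_ge0 //.
  rewrite ge0_ler_powR ?nnegrE ?invr_ge0 ?(ltW p_gt0) ?powR_ge0 ?mulr_ge0 ?powR_ge0 //.
  apply: le_trans h _; rewrite mulrAC ler_wpM2l ?mulr_ge0 //.
  rewrite ge0_ler_powR ?nnegrE ?subr_ge0 ?(ltW p_lt1) // ler_nat ltnS.
  exact: ltnW.
have sup_ge0 : 0 <= norlund_log_max mu (fun n => n%:R `^ (p^-1 - 1))%R f x.
  apply: le_trans (ereal_sup_ubound (ex_intro2 _ _ 2%N (leqnn 2) erefl)).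
  by rewrite lee_fin divr_ge0 ?normc_ge0 ?powR_ge0.
rewrite gee0_abs //.
apply: (@le_trans _ _ (((B%:R * g) `^ p^-1)%:E `^ p)).
  apply: gt0_ler_poweR; rewrite ?(ltW p_gt0) ?in_itv /= ?leey ?andbT //.
  by rewrite lee_fin powR_ge0.
by rewrite poweR_EFin -powRrM (mulrC p^-1%R) pV powRr1 ?mulr_ge0.
Qed.

(** L_n f involves only S_k f with k < n <= M_n, hence is constant on cosets of level [n]; a
    countable supremum remains measurable. *)
Lemma measurable_norlund_log_max w :
  measurable_fun [set: vilenkin m] (norlund_log_max mu w f).
Proof.
suff mL n : measurable_fun [set: vilenkin m]
    (fun x => (normc (norlund_log mu f n x) / w n.+1)%:E).
  exact: (measurable_fun_esups mL 2%N).
apply: (measurable_cylconst m_ge2 (n := n)).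
apply: (cylconst_comp (fun z => (normc z / w n.+1)%:E)) => x y xy.
have e k : (1 <= k < n)%N ->
    (psum (mfourier mu f) k y / (n - k)%:R = psum (mfourier mu f) k x / (n - k)%:R)%R.
  move=> /andP[_ kn]; have kM := ltnW (ltn_trans kn (ltn_genM m_ge2 n)).
  by rewrite (cylconst_psum m_ge2 (mfourier mu f) kM xy).
rewrite !norlund_logE; move: (real_complex R _)^-1%R => l.
exact: (congr1 (fun z => l * z)%R (eq_big_nat _ _ e)).
Qed.

Lemma cylconst_local_max j :
  cylconst j (fun x => \int[mu]_(y in cyl j x) max_pow y).
Proof.
move=> x y xy; congr integral.
by apply/seteqP; split=> z; apply: cyl_trans => //; exact: cyl_sym.
Qed.

(** Integrate term by term: the inner integral is constant on cosets of level [j], each of measure 1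
    / M_j, so the factor M_j^p becomes M_j^(p-1). *)
Lemma integral_majorant : \int[mu]_x max_pow x < +oo -> \int[mu]_x majorant x =
  (\sum_(j <oo) ((M j)%:R `^ (p - 1))%:E) * \int[mu]_x max_pow x.
Proof.
move=> int_lty.
have int_ge0 (D : set (vilenkin m)) : 0 <= \int[mu]_(y in D) max_pow y.
  by apply: integral_ge0 => y _; exact: max_pow_ge0.
have cj j : cylconst j (fun x => ((M j)%:R `^ p)%:E * \int[mu]_(y in cyl j x) max_pow y).
  exact: (cylconst_comp (fun z => ((M j)%:R `^ p)%:E * z) (@cylconst_local_max j)).
rewrite integral_nneseries //; last 2 first.
- by move=> j; exact: measurable_cylconst (cj j).
- by move=> j x _; exact: local_max_ge0.
have int_fin : \int[mu]_x max_pow x \is a fin_num by rewrite ge0_fin_numE.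
rewrite muleC -(fineK int_fin) -nneseriesZl; last first.
  by move=> j _; rewrite lee_fin powR_ge0.
apply: eq_eseriesr => j _.
rewrite fineK // (ge0_integral_cylconst m_ge2 mu_haar (cj j) (local_max_ge0 j)).
rewrite (ge0_integral_cyl m_ge2 mu j measurable_max_pow max_pow_ge0).
rewrite -ge0_sume_distrl; last by move=> v _; exact: local_max_ge0.
rewrite -ge0_sume_distrr; last by move=> v _; exact: int_ge0.
rewrite [X in X * _ = _]muleC -muleA -EFinM; congr (_ * _); congr EFin.
rewrite powRB ?powRr1 // -?natr1 //.
by apply/implyP => _; rewrite gt_eqF.
Qed.

(** Since M_j >= 2^j and p - 1 < 0, the terms are dominated by those of a geometric series of ratio
    2^(p-1) < 1. *)
Lemma series_genM_le :
  \sum_(j <oo) ((M j)%:R `^ (p - 1))%:E <= ((1 - 2 `^ (p - 1))^-1)%:E :> \bar R.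
Proof.
have q_gt0 : (0 < 2 `^ (p - 1) :> R)%R by rewrite powR_gt0.
have q_lt1 : (2 `^ (p - 1) < 1 :> R)%R.
  have : (1 `^ (1 - p) < 2 `^ (1 - p) :> R)%R.
    by rewrite gt0_ltr_powR ?nnegrE ?subr_gt0 // ltr1n.
  by rewrite powR1 -[in X in _ -> X]opprB powRN invf_lt1 // powR_gt0.
apply: lime_le; first by apply: is_cvg_nneseries => j _ _; rewrite lee_fin powR_ge0.
apply: nearW => n; rewrite sumEFin lee_fin.
apply: (@le_trans _ _ (series (geometric 1 (2 `^ (p - 1))) n : R)%R).
  rewrite /series /=; apply: ler_sum => j _; rewrite mul1r.
  rewrite -powR_mulrn ?powR_ge0 // -powRrM mulrC powRrM powR_mulrn //.
  rewrite -opprB !powRN lef_pV2 ?posrE ?powR_gt0 ?exprn_gt0 //.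
  rewrite ge0_ler_powR ?nnegrE ?subr_ge0 ?(ltW p_lt1) ?exprn_ge0 //.
  by rewrite -natrX ler_nat leq_exp2_genM.
apply: le_trans (geometric_le_lim _ _ _ _) _ => //; last by rewrite mul1r.
by rewrite gtr0_norm.
Qed.

End UpperBound.

(** * Test martingales for the negative result *)

Section LowerBound.
Local Set Implicit Arguments.
Local Unset Strict Implicit.
Import ComplexField.Normc.
Context {R : realType} {m : nat -> nat} (m_ge2 : forall k, (2 <= m k)%N).
Context (mu : probability (vilenkin m) R) (mu_haar : is_haar mu).
Context (p : R) (p_gt0 : 0 < p).
Implicit Types (x y : vilenkin m) (a i j k n v N : nat).

Local Notation M := (genM m).
Local Notation psi := (@psi R m).
Local Notation psum := (@psum R m).
Local Notation o := (vrep m 0).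

(** All digits of 0 vanish, so [o] is the neutral element and [dirichlet k x o] is the usual
    D_k(x). *)
Lemma psi_vrep0 i : psi i o = 1.
Proof.
rewrite /psi big1 // => k _; rewrite rademacherE.
have -> : (o k : nat) = 0%N.
  by apply: etrans (vrepE m_ge2 _ _) _; rewrite /digit div0n mod0n.
by rewrite mulr0 mul0r cis0 expr1n.
Qed.

Lemma normc_psi i x : normc (psi i x) = 1.
Proof.
rewrite /psi; apply: (big_ind (fun z => normc z = 1)) => [|z w z1 w1|k _].
- exact: normc1.
- by rewrite normcM z1 w1 mulr1.
- by rewrite normcX rademacherE normc_cis expr1n.
Qed.

Lemma psum_lt a k x :
  psum (fun i => ((i < a)%N)%:R) k x = dirichlet (minn k a) x o.
Proof.
have dE n : dirichlet n x o = \sum_(0 <= i < n) psi i x.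
  by rewrite big_mkord; apply: eq_bigr => i _; rewrite psi_vrep0 rmorph1 mulr1.
rewrite dE /Defs.psum -(big_mkord xpredT (fun i => ((i < a)%N)%:R * psi i x)).
rewrite (@big_cat_nat _ _ _ (minn k a)) ?geq_minl //= [X in _ + X]big_nat_cond.
rewrite [X in _ + X]big1 ?addr0 => [|i /andP[/andP[h1 h2] _]]; last first.
  by rewrite (_ : (i < a)%N = false) ?mul0r //; lia.
apply: eq_big_nat => i /andP[_ h].
by rewrite (_ : (i < a)%N = true) ?mul1r //; lia.
Qed.

(* The coefficients of D_(M_(N+1)) - D_(M_N). *)
Definition atom_coef N i : R[i] := ((i < M N.+1)%N)%:R - ((i < M N)%N)%:R.

(** This is 0 for n <= N and D_(M_(N+1)) - D_(M_N) for n > N. *)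
Definition atom N n : vilenkin m -> R[i] := psum (atom_coef N) (M n).

Lemma psum_atom_coef N k x : psum (atom_coef N) k x =
  dirichlet (minn k (M N.+1)) x o - dirichlet (minn k (M N)) x o.
Proof.
rewrite -!psum_lt /Defs.psum -sumrB; apply: eq_bigr => i _.
by rewrite /atom_coef mulrBl.
Qed.

Lemma ltn_genMS N : (M N < M N.+1)%N.
Proof. by rewrite genMS ltn_Pmull ?genM_gt0. Qed.

Lemma normc_atom_le N n x :
  normc (atom N n x) <= (2 * (M N.+1)%:R) * \1_(cyl N o) x.
Proof.
rewrite /atom psum_atom_coef.
have [nN|Nn] := leqP n N.
  rewrite !(minn_idPl _) ?leq_genM // 1?ltnW // subrr normc0.
  by rewrite !mulr_ge0 // indicE.
rewrite !(minn_idPr _) ?leq_genM // 1?ltnW // !dirichlet_genM // indicE.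
case: (boolP (x \in cyl N o)) => [xN|/negP xN].
  apply: le_trans (le_normcD _ _) _; rewrite normcN mulr1 mulrDl !mul1r.
  apply: lerD; case: asboolP => _; rewrite ?normc0 ?ler0n // normc_nat //.
  by rewrite ler_nat ltnW // ltn_genMS.
have xN' : ~ cyl N x o by move=> h; apply: xN; rewrite inE; exact: cyl_sym.
rewrite !asboolF ?subrr ?normc0 ?mulr0 //.
by move=> /(cyl_le (leqnSn N)).
Qed.

Lemma is_martingale_atom N : is_martingale mu (atom N).
Proof. exact: is_martingale_psum. Qed.

Local Open Scope ereal_scope.

(** The maximal function is at most 2 M_(N+1) on I_N(o), a set of measure 1 / M_N, and vanishes
    elsewhere. *)
Lemma hardy_norm_atom_le N :
  hardy_norm mu p (atom N) <=
    (2 * (M N.+1)%:R * ((M N)%:R `^ p^-1)^-1)%:E.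
Proof.
set K : R := (2 * (M N.+1)%:R)%R.
have K0 : (0 <= K)%R by rewrite mulr_ge0.
have f_mart := is_martingale_atom N.
have max_le x : max_pow p (atom N) x <= (K `^ p)%:E * (\1_(cyl N o) x)%:E.
  have ge0 : 0 <= martingale_max (atom N) x.
    apply: le_trans (ereal_sup_ubound (ex_intro2 _ _ 0%N I erefl)).
    by rewrite lee_fin normc_ge0.
  have le1 : martingale_max (atom N) x <= (K * \1_(cyl N o) x)%:E.
    by apply: ge_ereal_sup => _ [n _ <-]; rewrite lee_fin normc_atom_le.
  rewrite /max_pow gee0_abs //.
  apply: (@le_trans _ _ ((K * \1_(cyl N o) x)%:E `^ p)).
    apply: gt0_ler_poweR; rewrite ?(ltW p_gt0) ?in_itv /= ?leey ?andbT //.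
    by rewrite lee_fin mulr_ge0 // indicE.
  rewrite poweR_EFin powRM ?indicE // -EFinM lee_fin.
  by case: (_ \in _); rewrite ?powR1 // powR0 // gt_eqF.
have int_le : \int[mu]_x max_pow p (atom N) x <= (K `^ p / (M N)%:R)%:E.
  apply: (@le_trans _ _ (\int[mu]_x ((K `^ p)%:E * (\1_(cyl N o) x)%:E))).
    apply: ge0_le_integral => //.
    - by move=> x _; exact: max_pow_ge0.
    - exact: (measurable_max_pow m_ge2 p f_mart).
    - apply/measurable_EFinP/measurable_funM => //.
      by apply: measurable_indic; exact: measurable_cyl.
  rewrite ge0_integralZl_EFin ?powR_ge0 //; last first.
    by apply/measurable_EFinP/measurable_indic; exact: measurable_cyl.
  rewrite integral_indic ?setIT //; last exact: measurable_cyl.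
  rewrite EFinM; apply: lee_wpmul2l; first by rewrite lee_fin powR_ge0.
  by rewrite le_eqVlt; apply/orP; left; apply/eqP; exact: haar_cyl.
rewrite /hardy_norm unlock.
apply: (@le_trans _ _ ((K `^ p / (M N)%:R)%:E `^ p^-1)).
  apply: gt0_ler_poweR; rewrite ?invr_ge0 ?(ltW p_gt0) ?in_itv /= ?leey ?andbT //.
    by apply: integral_ge0 => x _; exact: poweR_ge0.
  by rewrite lee_fin divr_ge0 ?powR_ge0.
rewrite poweR_EFin lee_fin powRM ?invr_ge0 ?powR_ge0 // -powRrM divff ?gt_eqF //.
rewrite powRr1 //.
have -> // : ((M N)%:R^-1 `^ p^-1 = ((M N)%:R `^ p^-1)^-1 :> R)%R.
by rewrite -powR_inv1 // powRAC powR_inv1 // powR_ge0.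
Qed.

(** The partial sums vanish up to k = M_N, and the only remaining index M_N + 1 has weight 1 / (n -
    k) = 1 and partial sum psi_(M_N), of modulus 1. *)
Lemma normc_norlund_log_atom N x :
  (normc (norlund_log mu (atom N) (M N).+2 x) = (log_weight (M N).+2)^-1)%R.
Proof.
rewrite norlund_logE normcM normcV normc_real.
rewrite gtr0_norm ?log_weight_gt0 // big_nat_recr //= [X in (X + _)%R]big_nat_cond.
have coefE k : psum (mfourier mu (atom N)) k x = psum (atom_coef N) k x.
  by apply: eq_bigr => i _; rewrite mfourier_psum.
rewrite [X in (X + _)%R]big1 => [|k /andP[/andP[k1 kM] _]]; last first.
  rewrite coefE psum_atom_coef !(minn_idPl _) ?subrr ?mul0r //.
  by rewrite (leq_trans _ (ltnW (ltn_genMS N))).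
rewrite add0r coefE psum_atom_coef (minn_idPl (ltn_genMS N)).
rewrite (minn_idPr (leqnSn _)) /dirichlet big_ord_recr /= addrAC subrr add0r.
rewrite psi_vrep0 rmorph1 mulr1 subSn // subnn invr1 mulr1.
by rewrite normc_psi mulr1.
Qed.

Lemma norlund_log_max_atom_ge (w : nat -> R) N x :
  ((log_weight (M N).+2)^-1 / w (M N).+3)%:E <= norlund_log_max mu w (atom N) x.
Proof.
apply: ereal_sup_ubound; exists (M N).+2 => //=.
by rewrite normc_norlund_log_atom.
Qed.

Lemma Lnorm_norlund_log_atom_ge (w : nat -> R) N : (0 < w (M N).+3)%R ->
  ((log_weight (M N).+2)^-1 / w (M N).+3)%:E <=
    'N[mu]_(p%:E)[norlund_log_max mu w (atom N)].
Proof.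
move=> w0; set e := (_ / _)%R.
have e0 : (0 <= e)%R.
  by rewrite divr_ge0 ?(ltW w0) // invr_ge0 ltW // log_weight_gt0.
rewrite unlock; apply: (@le_trans _ _ ((e `^ p)%:E `^ p^-1)).
  by rewrite poweR_EFin -powRrM divff ?gt_eqF // powRr1.
apply: gt0_ler_poweR; rewrite ?invr_ge0 ?(ltW p_gt0) ?in_itv /= ?leey ?andbT //.
- by rewrite lee_fin powR_ge0.
- by apply: integral_ge0 => x _; exact: poweR_ge0.
(* On a probability space a constant is its own integral. *)
have -> : (e `^ p)%:E = \int[mu]_x (cst (e `^ p)%:E x).
  rewrite integral_cst // -[LHS]mule1; congr (_ * _)%E.
  by apply/esym; exact: (@probability_setT _ _ _ mu).
apply: ge0_le_integral => //.
- by move=> x _; rewrite lee_fin powR_ge0.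
- apply: (measurableT_comp (measurable_poweR p)).
  apply: measurableT_comp => //.
  exact: measurable_norlund_log_max.
move=> x _; rewrite /cst -poweR_EFin; apply: gt0_ler_poweR;
  rewrite ?(ltW p_gt0) ?in_itv /= ?leey ?andbT //.
apply: le_trans (lee_abs _); exact: norlund_log_max_atom_ge.
Qed.

End LowerBound.

(** * Growth of l_n and the limsup condition *)

Section LogWeight.
Context {R : realType}.

(** Induction from 1/(n+1) <= ln((n+1)/n), which is ln(1 + t) <= t at t = -1/(n+1). *)
Lemma log_weight_le n : (1 <= n)%N -> log_weight (R := R) n.+1 <= 1 + ln n%:R.
Proof.
case: n => // n _; elim: n => [|n ih].
  by rewrite /log_weight big_nat1 invr1 ln1 addr0.
rewrite /log_weight big_nat_recr //=; apply: le_trans (lerD ih (lexx _)) _.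
rewrite -addrA lerD2l.
have n0 : 0 < n.+1%:R :> R by rewrite ltr0n.
have n1 : 0 < n.+2%:R :> R by rewrite ltr0n.
have : ln (1 + (- n.+2%:R^-1)) <= - n.+2%:R^-1 :> R.
  by apply: le_ln1Dx; rewrite ltrN2 invf_lt1 // ltr1n.
have -> : 1 - n.+2%:R^-1 = n.+1%:R / n.+2%:R :> R.
  by rewrite -[in RHS](addrK 1 n.+1%:R) natr1 mulrBl divff ?gt_eqF // mul1r.
rewrite ln_div ?posrE // => h.
by rewrite -lerBrDl -lerN2 opprB.
Qed.

Lemma log_weight_le_ln n q : (2 <= n)%N -> (q <= n)%N ->
  log_weight (R := R) q.+1 <= (1 + (ln 2)^-1) * ln n%:R.
Proof.
move=> n2 qn.
have ln2 : 0 < ln 2 :> R by rewrite ln_gt0 // ltr1n.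
have n0 : 0 < n%:R :> R by rewrite ltr0n; lia.
have h : ln 2 <= ln n%:R :> R by rewrite ler_ln ?posrE // ler_nat.
case: q qn => [|q] qn.
  rewrite /log_weight big_geq // mulr_ge0 ?addr_ge0 ?invr_ge0 ?(ltW ln2) //.
  exact: le_trans (ltW ln2) h.
apply: le_trans (log_weight_le _ _) _ => //.
(* The additive 1 is absorbed by ln n / ln 2, as n >= 2. *)
rewrite mulrDl mul1r addrC; apply: lerD.
  by rewrite ler_ln ?posrE // ler_nat.
by rewrite mulrC ler_pdivlMr // mul1r.
Qed.

(** Otherwise [D] bounds the tail from [n0] on, hence also the limsup, an infimum of tail
    suprema. *)
Lemma limn_esup_pinfty_unbounded (u : nat -> R) (D : R) n0 :
  limn_esup (fun n => (u n)%:E) = +oo%E -> exists2 n, (n0 <= n)%N & D < u n.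
Proof.
move=> u_lim; apply: contrapT => h.
have : (limn_esup (fun n => (u n)%:E) <= D%:E)%E; last first.
  by rewrite u_lim leye_eq.
apply: le_trans (ereal_inf_lbound _) _.
  exists [set n | (n0 <= n)%N]; last reflexivity.
  exact: nbhs_infty_ge.
apply: ge_ereal_sup => _ [n /= n0n <-]; rewrite lee_fin leNgt.
by apply/negP => Du; apply: h; exists n.
Qed.

End LogWeight.

(** * Conclusion of both halves *)

Section Boundedness.
Context (R : realType) (m : nat -> nat).
Context (m_ge2 : forall k, (2 <= m k)%N) (B : nat) (m_le : forall k, (m k <= B)%N).
Context (mu : probability (vilenkin m) R) (mu_haar : is_haar mu).
Context (p : R) (p_gt0 : 0 < p) (p_lt1 : p < 1).
Local Notation M := (genM m).

Lemma norlund_log_max_bounded :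
  bounded_hardy_L mu p (norlund_log_max mu (fun n => n%:R `^ (p^-1 - 1))).
Proof.
(* [B] comes from the pointwise majorant, the other factor from the geometric series; the operator
   constant is K^(1/p). *)
pose K : R := B%:R * (1 - 2 `^ (p - 1))^-1.
have q_lt1 : 2 `^ (p - 1) <= 1 :> R.
  by rewrite -[leRHS](powRr0 2) ler_powR ?ler1n // subr_le0 ltW.
have K0 : 0 <= K by rewrite mulr_ge0 // invr_ge0 subr_ge0.
exists (K `^ p^-1) => f [f_mart f_fin].
have maxE : (hardy_norm mu p f = (\int[mu]_x max_pow p f x) `^ p^-1)%E.
  by rewrite /hardy_norm unlock.
have int_ge0 : (0 <= \int[mu]_x max_pow p f x)%E.
  by apply: integral_ge0 => x _; exact: max_pow_ge0.
have int_lty : (\int[mu]_x max_pow p f x < +oo)%E.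
  by apply: (@lty_poweRy _ _ p^-1); rewrite ?invr_neq0 ?gt_eqF // -maxE.
have maj_meas : measurable_fun [set: vilenkin m] (majorant mu p f).
  apply: ge0_emeasurable_sum => [j x _ _|j _]; first exact: local_max_ge0.
  apply: (measurable_cylconst m_ge2 (n := j)).
  apply: (cylconst_comp (fun z => ((M j)%:R `^ p)%:E * z)%E).
  exact: cylconst_local_max.
rewrite maxE -poweR_EFin -poweRM // unlock.
apply: gt0_ler_poweR; rewrite ?invr_ge0 ?(ltW p_gt0) ?in_itv /= ?leey ?andbT //.
- by apply: integral_ge0 => x _; exact: poweR_ge0.
- by rewrite mule_ge0.
apply: (@le_trans _ _ (\int[mu]_x (B%:R%:E * majorant mu p f x))%E).
  apply: ge0_le_integral => //.
  - by move=> x _; exact: poweR_ge0.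
  - apply: (measurableT_comp (measurable_poweR p)).
    by apply: measurableT_comp => //; exact: measurable_norlund_log_max.
  - by apply: measurable_funeM.
  - by move=> x _; exact: norlund_log_max_majorant.
rewrite ge0_integralZl_EFin //; last by move=> x _; exact: majorant_ge0.
rewrite integral_majorant // muleA lee_wpmul2r // /K EFinM.
by apply: lee_wpmul2l => //; exact: series_genM_le.
Qed.

Lemma norlund_log_max_unbounded (phi : nat -> R) :
  (forall n, (1 <= n)%N -> 1 <= phi n) ->
  (forall n k, (1 <= n)%N -> (n <= k)%N -> phi n <= phi k) ->
  limn_esup (fun n => (n%:R `^ (p^-1 - 1) / (ln n%:R * phi n))%:E) = +oo%E ->
  ~ bounded_hardy_L mu p (norlund_log_max mu phi).
Proof.
move=> phi_ge1 phi_nd phi_sup [C hC].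
set al := p^-1 - 1 in phi_sup *.
have al_ge0 : 0 <= al by rewrite subr_ge0 invf_ge1 // ltW.
pose c : R := 1 + (ln 2)^-1.
(* The product of the constants in [h3], [h2] and [lle], chosen so that n^al <= D ln n phi(n)
   contradicts the choice of [n]. *)
pose D : R := (B + 2)%:R `^ al * (`|C| * (2 * B%:R) * c).
have [n n4 Dn] := @limn_esup_pinfty_unbounded _ _ D 4 phi_sup.
(* [n >= 4 = M_0 + 3] provides such an [N]. The shift by 3 is the argument of the weight for
   L_(M_N+2), so monotonicity compares its value with phi(n). *)
have [N MN nM] : exists2 N, (M N + 3 <= n)%N & (n < M N.+1 + 3)%N.
  have ex : exists N, (n < M N + 3)%N.
    by exists n; have := ltn_genM m_ge2 n; lia.
  case: (ex_minnP ex) => -[|N]; first by rewrite genM0; lia.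
  move=> nN min; exists N => //; rewrite leqNgt; apply/negP => /min.
  by rewrite ltnn.
have MN0 : 0 < (M N)%:R :> R by rewrite ltr0n genM_gt0.
set l : R := log_weight (M N).+2.
have l0 : 0 < l by exact: log_weight_gt0.
have lln : 0 < ln n%:R :> R by rewrite ln_gt0 // ltr1n; lia.
have lle : l <= c * ln n%:R by apply: log_weight_le_ln; lia.
have phin : 0 < phi n by apply: lt_le_trans (phi_ge1 n _) => //; lia.
have phi3 : 0 < phi (M N).+3 by apply: lt_le_trans (phi_ge1 _ _).
have phile : phi (M N).+3 <= phi n by apply: phi_nd => //; rewrite -addn3.
(* The assumed inequality tested on [atom N]; [C] may be negative, hence its absolute value. *)
have h1 : l^-1 / phi (M N).+3 <= `|C| * (2 * (M N.+1)%:R * ((M N)%:R `^ p^-1)^-1).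
  rewrite -lee_fin; apply: le_trans (Lnorm_norlund_log_atom_ge m_ge2 mu_haar p_gt0 phi3) _.
  have atom_hardy : hardy mu p (atom N).
    split; first exact: is_martingale_atom.
    exact: le_lt_trans (hardy_norm_atom_le m_ge2 mu_haar p_gt0 N) (ltry _).
  apply: le_trans (hC _ atom_hardy) _; rewrite EFinM.
  apply: (@le_trans _ _ (`|C|%:E * hardy_norm mu p (atom N))%E).
    by apply: lee_wpmul2r; [exact: Lnorm_ge0|rewrite lee_fin ler_norm].
  apply: lee_wpmul2l; first by rewrite lee_fin.
  exact: hardy_norm_atom_le.
have MS : (M N.+1)%:R <= B%:R * (M N)%:R :> R.
  by rewrite genMS -natrM ler_nat leq_mul2r m_le orbT.
have Mal : (M N)%:R `^ p^-1 = (M N)%:R * (M N)%:R `^ al.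
  rewrite -[in LHS](subrK 1 p^-1) [in LHS]addrC powRD ?powRr1 //.
  by apply/implyP => _; rewrite gt_eqF.
have Mal0 : 0 < (M N)%:R `^ al by rewrite powR_gt0.
have h2 : (M N)%:R `^ al <= `|C| * (2 * B%:R) * (l * phi (M N).+3).
  rewrite -ler_pdivrMr ?mulr_gt0 // invfM mulrC -ler_pdivlMr //.
  apply: le_trans h1 _; rewrite Mal -[leRHS]mulrA; apply: ler_wpM2l => //.
  rewrite invfM mulrA ler_wpM2r ?invr_ge0 ?(ltW Mal0) //.
  by rewrite ler_pdivrMr // -!mulrA ler_pM2l.
(* n <= m_N M_N + 2 <= (B + 2) M_N, because M_N >= 1. *)
have h3 : n%:R `^ al <= (B + 2)%:R `^ al * (M N)%:R `^ al.
  rewrite -powRM // ge0_ler_powR ?nnegrE ?mulr_ge0 // -natrM ler_nat.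
  have mB : (m N * M N <= B * M N)%N by rewrite leq_mul2r m_le orbT.
  move: nM mB (genM_gt0 m_ge2 N); rewrite genMS mulnDl.
  by move: (m N * M N)%N (B * M N)%N (M N) => a b d; clear; lia.
move: Dn; apply/negP; rewrite -leNgt ler_pdivrMr ?mulr_gt0 //.
apply: le_trans h3 _; rewrite /D -[leRHS]mulrA; apply: ler_wpM2l; first exact: powR_ge0.
apply: le_trans h2 _; rewrite -[leRHS]mulrA; apply: ler_wpM2l; first by rewrite !mulr_ge0.
by rewrite mulrA; apply: ler_pM => //; exact: ltW.
Qed.

End Boundedness.

Theorem mainTheorem18 (R : realType) (m : nat -> nat)
    (m_ge2 : forall k, (2 <= m k)%N)
    (m_bounded : exists B : nat, forall k, (m k <= B)%N)
    (mu : probability (vilenkin m) R) (mu_haar : is_haar mu)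
    (p : R) (p_gt0 : 0 < p) (p_lt1 : p < 1) :
  bounded_hardy_L mu p
    (norlund_log_max mu (fun n => n%:R `^ (p^-1 - 1))) /\
  (forall phi : nat -> R,
     (forall n, (1 <= n)%N -> 1 <= phi n) ->
     (forall n k, (1 <= n)%N -> (n <= k)%N -> phi n <= phi k) ->
     limn_esup (fun n => (n%:R `^ (p^-1 - 1) / (ln n%:R * phi n))%:E) = +oo%E ->
     ~ bounded_hardy_L mu p (norlund_log_max mu phi)).

Proof.
case: m_bounded => B m_le; split.
  exact: (norlund_log_max_bounded R m m_ge2 B m_le mu mu_haar p p_gt0 p_lt1).
move=> phi phi_ge1 phi_nd phi_sup.
exact: (norlund_log_max_unbounded R m m_ge2 B m_le mu mu_haar p p_gt0 p_lt1 phi).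
Qed.
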